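(* Let $I \subset \mathbb{R}$ be an interval and let $x_0 \in I$. The family of all quasi-arithmetic means $A^{[f]}$ generated by continuous, strictly monotone functions $f \colon I \to \mathbb{R}$ that are differentiable at $x_0$ with $f'(x_0) \neq 0$ is an interval-type set in the family of all quasi-arithmetic means on $I$.
   Context: For an interval $I\subset\mathbb{R}$ and a continuous, strictly monotone function $f \colon I \to \mathbb{R}$, the quasi-arithmetic mean generated by $f$ is the function $A^{[f]} \colon \bigcup_{n=1}^\infty I^n \to I$, $A^{[f]}(a_1,\dots,a_n) := f^{-1}\left(\frac{f(a_1)+\cdots+f(a_n)}{n}\right)$. For two such functions $f,g$ on the same interval $I$, $A^{[f]} \le A^{[g]}$ means $A^{[f]}(a) \le A^{[g]}(a)$ for all $a \in \bigcup_{n=1}^\infty I^n$. A set $\mathcal{I}$ of quasi-arithmetic means on $I$ is called an interval-type set (or interval) if, whenever $A^{[f]}, A^{[g]} \in \mathcal{I}$ and $A^{[h]}$ is a quasi-arithmetic mean on $I$ with $A^{[f]} \le A^{[h]} \le A^{[g]}$, then $A^{[h]} \in \mathcal{I}$. If $x_0$ is an endpoint of $I$, differentiability at $x_0$ is understood as one-sided differentiability relative to $I$. *)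

(* Defs.v *)
(* MathComp-Analysis; the real line is an arbitrary [R : realType]. *)
From HB Require Import structures.
From mathcomp Require Export all_boot all_order all_algebra.
From mathcomp Require Export all_classical all_reals all_analysis.

Set Implicit Arguments.
Unset Strict Implicit.
Unset Printing Implicit Defensive.

Import Order.TTheory GRing.Theory Num.Theory.
Import numFieldNormedType.Exports.

Local Open Scope classical_set_scope.
Local Open Scope ring_scope.

(* Functions on I are represented by total functions R -> R of which only the
   values on I matter, and a tuple in I^n by the list of its n entries. *)

Definition strictly_monotone_on {R : realType} (I : set R) (f : R -> R) : Prop :=
  {in I &, {homo f : x y / x < y}} \/
  {in I &, {homo f : x y /~ x < y}}.

Definition generator {R : realType} (I : set R) (f : R -> R) : Prop :=
  {within I, continuous f} /\ strictly_monotone_on I f.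

(* The union of the powers I^n over n >= 1. *)
Definition powers {R : realType} (I : set R) : set (seq R) :=
  [set a | a != [::] /\ forall x, x \in a -> I x].

(* ['pinv_(fun=> 0) I f] is the inverse of the restriction of f to I; its
   default value is never used when f is a generator and I an interval.
   Patching with 0 outside the domain makes Leibniz equality of such functions
   the same as equality of the means as functions on [powers I]. *)
Definition qa_mean {R : realType} (I : set R) (f : R -> R) : seq R -> R :=
  patch (fun=> 0) (powers I)
    (fun a => 'pinv_(fun=> 0) I f ((\sum_(x <- a) f x) / (size a)%:R)).

Definition qa_means {R : realType} (I : set R) : set (seq R -> R) :=
  [set qa_mean I f | f in generator I].

Definition le_mean {R : realType} (I : set R) (M N : seq R -> R) : Prop :=
  forall a, powers I a -> M a <= N a.

Definition interval_type {R : realType} (I : set R) (S : set (seq R -> R)) : Prop :=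
  S `<=` qa_means I /\
  forall F G H : seq R -> R, S F -> S G -> qa_means I H ->
    le_mean I F H -> le_mean I H G -> S H.

(* [f] has derivative [l] at [x0] relative to I, hence one-sided when x0 is an
   endpoint of I. If I = {x0} the filter is improper and every l qualifies. *)
Definition has_deriv_within {R : realType} (I : set R) (f : R -> R) (x0 l : R) : Prop :=
  (f y - f x0) / (y - x0) @[y --> within I x0^'] --> l.

Definition means_diff_at {R : realType} (I : set R) (x0 : R) : set (seq R -> R) :=
  [set qa_mean I f | f in
    [set f | generator I f /\ exists2 l, has_deriv_within I f x0 l & l != 0]].

(* Main.v *)
(* Take f, g, h increasing with A^[f] <= A^[h] <= A^[g]. The first inequality
   makes h convex relative to f, so u(y) = (h y - h x0) / (f y - f x0) is
   nondecreasing in y; likewise v(y) = (g y - g x0) / (h y - h x0) is. Both are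
   positive and u v tends to g'(x0) / f'(x0) > 0, which forces u to converge to
   a positive limit; hence (h y - h x0) / (y - x0) = u(y) (f y - f x0) / (y - x0)
   converges to a nonzero limit. *)
Require Import Defs.
From mathcomp Require Import ring lra.

Set Implicit Arguments.
Unset Strict Implicit.
Unset Printing Implicit Defensive.

Import Order.TTheory GRing.Theory Num.Theory.
Import numFieldNormedType.Exports.

Local Open Scope classical_set_scope.
Local Open Scope ring_scope.

(** Trades the partial inverse for the equation it solves. This form survives replacing [f] by
    [- f], so the argument can work with increasing functions only. *)
Definition solves_mean {R : realType} (I : set R) (f : R -> R)
    (M : seq R -> R) : Prop :=
  forall a, powers I a ->
    I (M a) /\ f (M a) = (\sum_(x <- a) f x) / (size a)%:R.

(** Some entry lies at or below the average [m] and some entry at or above it: otherwise summing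
    strict inequalities would separate the sum of [s] from [size s] copies of [m]. *)
Lemma is_interval_avg (R : realType) (J : set R) (s : seq R) :
  is_interval J -> s != [::] -> (forall y, y \in s -> J y) ->
  J ((\sum_(y <- s) y) / (size s)%:R).
Proof.
move=> hJ s0 sJ; set m := _ / _.
have sz : 0 < (size s)%:R :> R by rewrite ltr0n lt0n size_eq0.
have sumE : \sum_(y <- s) y = \sum_(y <- s) m.
  by rewrite big_const_seq count_predT iter_addr_0 -mulr_natr divfK ?gt_eqF.
have [/hasP[u us um]|/hasPn nlt] := boolP (has (fun y => y <= m) s); last first.
  have : \sum_(y <- s) m < \sum_(y <- s) y.
    rewrite !big_seq; apply: ltr_sum => [|y ys]; last by rewrite ltNge nlt.
    by case: (s) s0 => //= y t _; rewrite inE eqxx.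
  by rewrite sumE ltxx.
have [/hasP[v vs vm]|/hasPn ngt] := boolP (has (fun y => m <= y) s); last first.
  have : \sum_(y <- s) y < \sum_(y <- s) m.
    rewrite !big_seq; apply: ltr_sum => [|y ys]; last by rewrite ltNge ngt.
    by case: (s) s0 => //= y t _; rewrite inE eqxx.
  by rewrite sumE ltxx.
by apply: (hJ u v); rewrite ?um ?vm//; exact: sJ.
Qed.

(** By continuity the image of [I] is connected, hence an interval, so it contains the average of
    values of [f] and the inverse is taken at an attained value. *)
Lemma generator_solves_mean (R : realType) (I : set R) (f : R -> R) :
  is_interval I -> generator I f -> solves_mean I f (qa_mean I f).
Proof.
move=> hI [cf _] a aI.
rewrite /qa_mean patchE mem_set//.
have hJ : is_interval (f @` I).
  apply/connected_intervalP/connected_continuous_connected => //.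
  exact/connected_intervalP.
case: aI => a0 aI.
have Jm : (f @` I) ((\sum_(x <- a) f x) / (size a)%:R).
  rewrite -(big_map f predT id) -(size_map f).
  apply: is_interval_avg => //; first by case: (a) a0.
  by move=> _ /mapP[x xa ->]; exists x => //; exact: aI.
split.
  have sf : set_surj I (f @` I) f by [].
  by apply: (surjpinv_image_sub sf); exact: imageP Jm.
by rewrite pinvK// mem_set.
Qed.

Lemma solves_meanN (R : realType) (I : set R) (f : R -> R) (M : seq R -> R) :
  solves_mean I f M -> solves_mean I (fun x => - f x) M.
Proof.
move=> fM a aI; have [MI ->] := fM _ aI; split=> //.
by rewrite sumrN mulNr.
Qed.

(* Testing the means on n - p copies of x and p copies of z gives the
   chord inequality at the rational weight p / n; monotonicity passes to real
   weights. *)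
Lemma le_mean_chord (R : realType) (I : set R) (f h : R -> R)
    (M N : seq R -> R) (x y z : R) :
  {in I &, {homo f : x y / x < y}} -> {in I &, {homo h : x y / x < y}} ->
  solves_mean I f M -> solves_mean I h N -> le_mean I M N ->
  I x -> I y -> I z -> x < y -> y < z ->
  (h y - h x) * (f z - f x) <= (f y - f x) * (h z - h x).
Proof.
move=> fi hi fM hN MN Ix Iy Iz xy yz.
have fxy : f x < f y by apply: fi; rewrite ?inE.
have fyz : f y < f z by apply: fi; rewrite ?inE.
have hxy : h x < h y by apply: hi; rewrite ?inE.
have hyz : h y < h z by apply: hi; rewrite ?inE.
have fxz : 0 < f z - f x by rewrite subr_gt0 (lt_trans fxy).
have hxz : 0 < h z - h x by rewrite subr_gt0 (lt_trans hxy).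
(* If the inequality fails, [f y] sits relatively lower between [f x] and [f z] than [h y] does
   between [h x] and [h z]. A rational weight [q] on [z] strictly between these two positions puts
   the mean [M] at or above [y] but the mean [N] below [y]. *)
rewrite leNgt; apply/negP; rewrite -ltr_pdivrMr// mulrAC -ltr_pdivlMr// => lt.
have [q] := rat_in_itvoo lt; rewrite in_itv/= => /andP[q1 q2].
have q0 : 0 < (ratr q : R) by apply: lt_trans q1; rewrite divr_gt0// subr_gt0.
have q_lt1 : (ratr q : R) < 1.
  by apply: lt_trans q2 _; rewrite ltr_pdivrMr// mul1r ltrD2r.
have [p [n [n0 pn qE]]] : exists p n : nat, [/\ (0 < n)%N, (p <= n)%N &
    ratr q = p%:R / n%:R :> R].
  have nq0 : 0 < numq q by rewrite numq_gt0 -(ltr0q R).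
  exists `|numq q|%N, `|denq q|%N.
  have qE : ratr q = `|numq q|%:R / `|denq q|%:R :> R.
    by rewrite /ratr !natr_absz gtr0_norm// normr_denq.
  split=> //; first by rewrite absz_gt0 denq_neq0.
  have d0 : 0 < `|denq q|%:R :> R by rewrite ltr0n absz_gt0 denq_neq0.
  by move: q_lt1; rewrite qE ltr_pdivrMr// mul1r ltr_nat => /ltnW.
have nR : n%:R != 0 :> R by rewrite pnatr_eq0 -lt0n.
pose a := nseq (n - p) x ++ nseq p z.
have sa : size a = n by rewrite size_cat !size_nseq subnK.
have aI : powers I a.
  split; first by rewrite -size_eq0 sa -lt0n.
  by move=> t; rewrite mem_cat !mem_nseq => /orP[]/andP[_ /eqP->].
have avg (k : R -> R) :
    (\sum_(t <- a) k t) / (size a)%:R = k x + ratr q * (k z - k x).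
  rewrite big_cat/= !big_nseq !iter_addr_0 sa -(mulr_natr (k x)).
  rewrite -(mulr_natr (k z)) natrB// qE.
  by field.
have [MI fMa] := fM _ aI; have [NI hNa] := hN _ aI.
have yM : y <= M a.
  rewrite -(le_mono_in fi) ?inE// fMa avg.
  by rewrite -lerBlDl -ler_pdivrMr// ltW.
have : h y <= h (N a).
  by rewrite (le_mono_in hi) ?inE// (le_trans yM)// MN.
by rewrite hNa avg -lerBlDl -ler_pdivrMr// leNgt q2.
Qed.

(** Each case is the chord inequality with denominators cleared: [x0] is the left, right or middle
    one of the three points according to its position relative to [s < t]. *)
Lemma le_mean_ratio_homo (R : realType) (I : set R) (f h : R -> R)
    (M N : seq R -> R) (x0 : R) :
  {in I &, {homo f : x y / x < y}} -> {in I &, {homo h : x y / x < y}} ->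
  solves_mean I f M -> solves_mean I h N -> le_mean I M N -> I x0 ->
  {in I `\ x0 &, {homo (fun y => (h y - h x0) / (f y - f x0)) :
    s t / s <= t}}.
Proof.
move=> fi hi fM hN MN I0 s t; rewrite !inE => -[Is /eqP s0] [It /eqP t0].
rewrite le_eqVlt => /predU1P[->//|st].
have lt2 u v : I u -> I v -> u < v -> f u < f v /\ h u < h v.
  by move=> Iu Iv uv; split; [apply: fi|apply: hi]; rewrite ?inE.
have K := le_mean_chord fi hi fM hN MN.
have [fst hst] := lt2 _ _ Is It st.
case: (ltgtP s x0) s0 => // s0 _; last first.
  have t0' := lt_trans s0 st.
  have [? ?] := lt2 _ _ I0 Is s0; have [? ?] := lt2 _ _ I0 It t0'.
  have := K _ _ _ I0 Is It s0 st.
  rewrite ler_pdivrMr ?subr_gt0// mulrAC ler_pdivlMr ?subr_gt0//.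
  by rewrite (mulrC (f s - _)).
(* Left of [x0] both increments are negative; flipping them gives a positive denominator to
   clear. *)
have flip y : (h y - h x0) / (f y - f x0) = (h x0 - h y) / (f x0 - f y).
  by rewrite -(opprB (h x0)) -(opprB (f x0)) invrN mulrNN.
have [? ?] := lt2 _ _ Is I0 s0; rewrite (flip s).
case: (ltgtP t x0) t0 => // t0 _.
  have [? ?] := lt2 _ _ It I0 t0; have := K _ _ _ Is It I0 st t0.
  rewrite (flip t).
  rewrite ler_pdivrMr ?subr_gt0// mulrAC ler_pdivlMr ?subr_gt0//; lra.
have [? ?] := lt2 _ _ I0 It t0; have := K _ _ _ Is I0 It s0 t0.
rewrite ler_pdivrMr ?subr_gt0// mulrAC ler_pdivlMr ?subr_gt0//; lra.
Qed.

(* For s <= t the increments of [ln u] and [ln v] are both nonnegative, so the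
   oscillation of [ln u] is at most that of [ln u + ln v], which converges. *)
Lemma cvg_homo_factor (R : realType) (F : set_system R) (FF : ProperFilter F)
    (D : set R) (u v : R -> R) (c : R) :
  F D -> (forall y, D y -> 0 < u y) -> (forall y, D y -> 0 < v y) ->
  {in D &, {homo u : s t / s <= t}} -> {in D &, {homo v : s t / s <= t}} ->
  0 < c -> u y * v y @[y --> F] --> c ->
  exists2 l : R, 0 < l & u y @[y --> F] --> l.
Proof.
move=> FD u0 v0 ui vi c0 uvc.
have lnuv : ln (u y * v y) @[y --> F] --> ln c.
  by apply: (continuous_cvg _ (continuous_ln c0)).
have osc s t : D s -> D t ->
    `|ln (u s) - ln (u t)| <= `|ln (u s * v s) - ln (u t * v t)|.
  wlog st : s t / s <= t.
    move=> H Ds Dt; have [/H|/ltW/H] := leP s t; first exact.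
    by rewrite distrC (distrC (ln (u s * _))); exact.
  move=> Ds Dt.
  have lu : ln (u s) <= ln (u t) by rewrite ler_ln ?posrE ?u0// ui ?inE.
  have lv : ln (v s) <= ln (v t) by rewrite ler_ln ?posrE ?v0// vi ?inE.
  rewrite !lnM ?posrE ?u0 ?v0// !ler0_norm; lra.
have : cauchy (ln (u y) @[y --> F]).
  apply/cauchy_ballP => e e0.
  have /cvg_cauchy/cauchy_ballP/(_ _ e0) : cvg (ln (u y * v y) @[y --> F]).
    by apply/cvg_ex; exists (ln c).
  rewrite !near_map2 => -[[A B] [FA FB] AB]; rewrite near_map2.
  (* The bound [osc] holds only between points of [D]. *)
  exists (A `&` D, B `&` D); first by split; exact: filterI.
  move=> [s t] [/= [As Ds] [Bt Dt]]; have := AB (s, t) (conj As Bt).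
  by rewrite /= -!ball_normE /=; exact/le_lt_trans/osc.
move=> /cauchy_cvgP/cvg_ex[/= l lP].
(* Undoing the logarithm yields a limit that is an exponential, hence positive. *)
exists (expR l); first exact: expR_gt0.
apply: cvg_trans (continuous_cvg _ (@continuous_expR R l) lP).
apply: near_eq_cvg; apply: filterS FD => y Dy /=.
by rewrite lnK// posrE u0.
Qed.

Lemma increasing_slope_gt0 (R : realType) (I : set R) (f : R -> R) (x0 y : R) :
  {in I &, {homo f : x y / x < y}} -> I x0 -> (I `\ x0) y ->
  0 < (f y - f x0) / (y - x0).
Proof.
move=> fi I0 [Iy /eqP]; case: (ltgtP y x0) => // yx _.
  by rewrite ltr_ndivlMr ?mul0r subr_lt0// fi ?inE.
by rewrite divr_gt0 ?subr_gt0// fi ?inE.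
Qed.

Lemma near_within_dnbhs_setD1 (R : realType) (I : set R) (x0 : R) :
  within I x0^' (I `\ x0).
Proof.
apply: filterS (withinT _ (nbhs_filter x0)) => y /= /eqP yx0 Iy.
by split.
Qed.

(** Slopes of an increasing function are positive, so their limit is nonnegative; properness of the
    filter makes that limit unique. *)
Lemma has_deriv_within_gt0 (R : realType) (I : set R) (f : R -> R) (x0 l : R) :
  {in I &, {homo f : x y / x < y}} -> I x0 ->
  ProperFilter (within I x0^') ->
  has_deriv_within I f x0 l -> l != 0 -> 0 < l.
Proof.
move=> fi I0 FF fl l0; rewrite lt_neqAle eq_sym l0/=.
rewrite -(cvg_lim _ fl)//; apply: limr_ge; first by apply/cvg_ex; exists l.
apply: filterS (near_within_dnbhs_setD1 I x0) => y Dy.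
exact/ltW/increasing_slope_gt0/Dy.
Qed.

Lemma has_deriv_withinN (R : realType) (I : set R) (f : R -> R) (x0 l : R) :
  has_deriv_within I f x0 l -> has_deriv_within I (fun x => - f x) x0 (- l).
Proof.
move=> fl; rewrite /has_deriv_within.
under eq_fun do rewrite -opprD mulNr.
exact: cvgN.
Qed.

Lemma has_deriv_within_sandwich (R : realType) (I : set R)
    (f g h : R -> R) (M N P : seq R -> R) (x0 lf lg : R) :
  {in I &, {homo f : x y / x < y}} -> {in I &, {homo g : x y / x < y}} ->
  {in I &, {homo h : x y / x < y}} ->
  solves_mean I f M -> solves_mean I g P -> solves_mean I h N ->
  le_mean I M N -> le_mean I N P ->
  I x0 -> ProperFilter (within I x0^') ->
  has_deriv_within I f x0 lf -> lf != 0 ->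
  has_deriv_within I g x0 lg -> lg != 0 ->
  exists2 l, has_deriv_within I h x0 l & l != 0.
Proof.
move=> fi gi hi fM gP hN MN NP I0 FF fl lf0 gl lg0.
have lf_gt0 := has_deriv_within_gt0 fi I0 FF fl lf0.
have lg_gt0 := has_deriv_within_gt0 gi I0 FF gl lg0.
have incr (k : R -> R) y : {in I &, {homo k : x y / x < y}} -> (I `\ x0) y ->
    k y - k x0 != 0.
  move=> ki Dy; have := increasing_slope_gt0 ki I0 Dy.
  by apply: contraTneq => ->; rewrite mul0r ltxx.
have ratio_gt0 (k1 k2 : R -> R) y : {in I &, {homo k1 : x y / x < y}} ->
    {in I &, {homo k2 : x y / x < y}} -> (I `\ x0) y ->
    0 < (k1 y - k1 x0) / (k2 y - k2 x0).
  move=> k1i k2i Dy; have yx0 : y - x0 != 0.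
    by rewrite subr_eq0; apply/eqP; case: Dy.
  have -> : (k1 y - k1 x0) / (k2 y - k2 x0) =
      (k1 y - k1 x0) / (y - x0) / ((k2 y - k2 x0) / (y - x0)).
    by field; rewrite yx0 incr.
  by apply: divr_gt0; exact: (increasing_slope_gt0 _ I0 Dy).
have FD := near_within_dnbhs_setD1 I x0.
have [l l_gt0 ul] : exists2 l : R, 0 < l &
    (h y - h x0) / (f y - f x0) @[y --> within I x0^'] --> l.
  apply: (cvg_homo_factor (D := I `\ x0) (c := lg / lf)
    (v := fun y => (g y - g x0) / (h y - h x0)) FF) => //.
  - by move=> y; exact: ratio_gt0.
  - by move=> y; exact: ratio_gt0.
  - exact: le_mean_ratio_homo fM hN MN I0.
  - exact: le_mean_ratio_homo hN gP NP I0.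
  - exact: divr_gt0.
  (* In the product the increment of [h] cancels, leaving the slope of [g] divided by that of
     [f]. *)
  apply: cvg_trans (cvgM gl (cvgV lf0 fl)).
  apply: near_eq_cvg; apply: filterS FD => y Dy /=.
  have yx0 : y - x0 != 0 by rewrite subr_eq0; apply/eqP; case: Dy.
  by field; rewrite !incr// yx0.
exists (l * lf); last by rewrite mulf_neq0// gt_eqF.
apply: cvg_trans (cvgM ul fl).
apply: near_eq_cvg; apply: filterS FD => y Dy /=.
have yx0 : y - x0 != 0 by rewrite subr_eq0; apply/eqP; case: Dy.
by field; rewrite !incr// yx0.
Qed.

(** Negating a decreasing generator keeps the mean and only changes the sign of the derivative. The
    equivalence is used forwards for the two bounding generators and backwards for the one in
    between. *)
Lemma increasing_representative (R : realType) (I : set R) (x0 : R)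
    (f : R -> R) : is_interval I -> generator I f ->
  exists f', [/\ {in I &, {homo f' : x y / x < y}},
    solves_mean I f' (qa_mean I f) &
    (exists2 l, has_deriv_within I f x0 l & l != 0) <->
    (exists2 l, has_deriv_within I f' x0 l & l != 0)].
Proof.
move=> hI fg; have fM := generator_solves_mean hI fg.
case: fg => _ [fi|fd]; first by exists f.
exists (fun x => - f x); split.
- by move=> x y xI yI xy; rewrite ltrN2 fd.
- exact: solves_meanN.
split=> -[l fl l0]; exists (- l); rewrite ?oppr_eq0//.
  exact: has_deriv_withinN.
have := has_deriv_withinN fl; congr has_deriv_within.
by apply/funext => x; rewrite opprK.
Qed.

Theorem theorem5 (R : realType) (I : set R) (x0 : R)
    (hI : is_interval I) (hx0 : I x0) :
  interval_type I (means_diff_at I x0).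
Proof.
split=> [_ [f [fg _] <-]|]; first by exists f.
move=> _ _ _ [f [fg fl] <-] [g [gg gl] <-] [h hg <-] fh hg'.
exists h => //; split=> //.
(* If [x0] is isolated in [I], the filter is improper and any nonzero number serves as a
   derivative. *)
have [F0|nF0] := pselect (within I x0^' set0).
  exists 1; last exact: oner_neq0.
  by move=> A _; apply: filterS F0.
have FF : ProperFilter (within I x0^').
  by apply: Build_ProperFilter => //; exact: within_filter.
have [f' [f'i fM /iffLR/(_ fl)[lf f'l lf0]]] :=
  increasing_representative x0 hI fg.
have [g' [g'i gM /iffLR/(_ gl)[lg g'l lg0]]] :=
  increasing_representative x0 hI gg.
have [h' [h'i hM /iffRL hl]] := increasing_representative x0 hI hg.
by apply: hl; exact: (has_deriv_within_sandwich f'i g'i h'i fM gM hM fh hg'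
  hx0 FF f'l lf0 g'l lg0).
Qed.
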